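(* Fix $(\alpha_0,T_0)$ with $0<\alpha_0<1$, $T_0>0$. On the thermodynamic part of the Hugoniot locus of $(\alpha_0,T_0)$, if $T\to0$ then $\alpha\to0$ and more precisely $$\alpha\sim\frac{2\alpha_0}{\sqrt{1-\alpha_0}}\left[1+\frac{T_{\rm i}\alpha_0}{2T_0(1+\alpha_0)}\right]^{\frac12}\left(\frac{T}{T_0}\right)^{\frac34}e^{-\frac{T_{\rm i}}{2T}+\frac{T_{\rm i}}{2T_0}}\quad\text{as }T\to0.$$ Furthermore, if $T\to\infty$ then $\alpha\to1$ and $$1-\alpha\sim4\,\frac{1-\alpha_0}{\alpha_0^2}\left(\frac{T}{T_0}\right)^{-\frac32}e^{-\frac{T_{\rm i}}{T_0}}\quad\text{as }T\to\infty.$$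
   Context: Fix positive constants $a^2$, $T_{\rm i}$, $\kappa$. For an ionized gas with degree of ionization $\alpha\in(0,1)$ and temperature $T>0$, put $p=\frac1\kappa\frac{1-\alpha^2}{\alpha^2}T^{5/2}e^{-T_{\rm i}/T}$, $v=a^2(1+\alpha)T/p$, $e=a^2\left[\frac32(1+\alpha)T+T_{\rm i}\alpha\right]$; $p_0,v_0,e_0$ are the values at $(\alpha_0,T_0)$. The thermodynamic part of the Hugoniot locus of $(\alpha_0,T_0)$ is the set of $(\alpha,T)$, $0<\alpha<1$, $T>0$, with $e-e_0+\frac12(p+p_0)(v-v_0)=0$. It is the graph of a strictly increasing function $T=T(\alpha)$ from $(0,1)$ onto $(0,\infty)$, whose inverse is $\alpha=\alpha(T)$. The symbol $\sim$ means that the ratio tends to $1$. *)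

(* Defs.v *)
From Stdlib Require Import Reals.
From Coquelicot Require Import Coquelicot.
Open Scope R_scope.

(* The pressure, with the degree of ionization [alpha] and the temperature [T]
   as independent variables (solved from Saha's ionization law).
   Powers with a non-integer exponent are [Rpower x y = exp (y * ln x)], which
   has its usual meaning for [0 < x]; they are only used on the range [0 < T]. *)
Definition pressure (Ti kappa alpha T : R) : R :=
  1 / kappa * ((1 - alpha ^ 2) / alpha ^ 2) * Rpower T (5 / 2) * exp (- (Ti / T)).

(* [a2] stands for the constant a^2. *)
Definition specific_volume (a2 Ti kappa alpha T : R) : R :=
  a2 * (1 + alpha) * T / pressure Ti kappa alpha T.

Definition internal_energy (a2 Ti alpha T : R) : R :=
  a2 * (3 / 2 * (1 + alpha) * T + Ti * alpha).

Definition hugoniot_locus (a2 Ti kappa alpha0 T0 alpha T : R) : Prop :=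
  let p := pressure Ti kappa alpha T in
  let p0 := pressure Ti kappa alpha0 T0 in
  let v := specific_volume a2 Ti kappa alpha T in
  let v0 := specific_volume a2 Ti kappa alpha0 T0 in
  let e := internal_energy a2 Ti alpha T in
  let e0 := internal_energy a2 Ti alpha0 T0 in
  0 < alpha < 1 /\ 0 < T /\ e - e0 + 1 / 2 * (p + p0) * (v - v0) = 0.

(* The locus is the graph of [T |-> alpha T] over (0, oo); this determines
   [alpha] on (0, oo), and its values elsewhere are irrelevant. *)
Definition is_locus_function (a2 Ti kappa alpha0 T0 : R) (alpha : R -> R) : Prop :=
  forall a T : R,
    hugoniot_locus a2 Ti kappa alpha0 T0 a T <-> 0 < T /\ a = alpha T.

Definition asymp_equiv (F : (R -> Prop) -> Prop) (f g : R -> R) : Prop :=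
  filterlim (fun x => f x / g x) F (locally 1).

(* Main.v *)
Require Import Defs.
From Stdlib Require Import Reals Lra.
From Coquelicot Require Import Coquelicot.
Open Scope R_scope.

(** The locus is governed by one scalar unknown, the pressure ratio
    [r = p / p0]. Dividing the Hugoniot equation by [a2] and writing
    [A = 2 (1 + alpha0) T0 + Ti alpha0], [B = (1 + alpha0) T0], it becomes

      [B / 2 * r + A = 2 (1 + alpha) T + Ti alpha + (1 + alpha) T / (2 r)],

    while Saha's law gives [r = (1 - alpha^2) / alpha^2 * G T] with
    [G T = alpha0^2 / (1 - alpha0^2) * (T / T0)^(5/2) * e^(Ti / T0 - Ti / T)].
    Everything then follows from the dominant balance in the first equation
    ([hugoniot_balance]).

    As [T] tends to 0, [G T / T] tends to 0. Multiplying the balance by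
    [alpha^4 r] bounds [alpha^4] by a multiple of [G T / T], so [alpha] tends
    to 0; then [r] tends to 0 as well, the balance reduces to
    [A ~ T / (2 r)], and eliminating [r] by Saha's law yields
    [alpha^2 ~ 2 A G T / T] ([cold_limit]). The announced equivalent is
    exactly the square root of [2 A G T / T].

    As [T] tends to infinity, the balance forces [r] to grow at least
    linearly, hence [r / T] is bounded; as [G T / T] tends to infinity, Saha's
    law forces [alpha] to tend to 1. The balance then reduces to
    [B / 2 * r ~ 4 T], and Saha's law yields [(1 - alpha) G T / T -> 4 / B]
    ([hot_limit]). *)

(** * Limits of real functions along a filter *)

Section RealLimits.

Context {X : Type} (F : (X -> Prop) -> Prop) {FF : Filter F}.

Lemma lim_eq (f : X -> R) (l l' : R) :
  l = l' -> filterlim f F (locally l) -> filterlim f F (locally l').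
Proof. now intros ->. Qed.

Lemma lim_plus (f g : X -> R) (l m : R) :
  filterlim f F (locally l) -> filterlim g F (locally m) ->
  filterlim (fun x => f x + g x) F (locally (l + m)).
Proof.
intros Hf Hg.
exact (filterlim_comp_2 f g Rplus Hf Hg (filterlim_plus l m)).
Qed.

Lemma lim_mult (f g : X -> R) (l m : R) :
  filterlim f F (locally l) -> filterlim g F (locally m) ->
  filterlim (fun x => f x * g x) F (locally (l * m)).
Proof.
intros Hf Hg.
exact (filterlim_comp_2 f g Rmult Hf Hg (filterlim_mult l m)).
Qed.

Lemma lim_continuous (h : R -> R) (f : X -> R) (l : R) :
  continuous h l -> filterlim f F (locally l) ->
  filterlim (fun x => h (f x)) F (locally (h l)).
Proof. intros Hh Hf. exact (filterlim_comp _ _ _ f h _ _ _ Hf Hh). Qed.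

Lemma lim_opp (f : X -> R) (l : R) :
  filterlim f F (locally l) -> filterlim (fun x => - f x) F (locally (- l)).
Proof.
intros Hf. apply (lim_continuous Ropp); [|exact Hf].
exact (filterlim_opp (V := R_NormedModule) l).
Qed.

Lemma lim_minus (f g : X -> R) (l m : R) :
  filterlim f F (locally l) -> filterlim g F (locally m) ->
  filterlim (fun x => f x - g x) F (locally (l - m)).
Proof. intros Hf Hg. apply lim_plus; [exact Hf|now apply lim_opp]. Qed.

Lemma lim_inv (f : X -> R) (l : R) :
  l <> 0 -> filterlim f F (locally l) ->
  filterlim (fun x => / f x) F (locally (/ l)).
Proof.
intros Hl Hf. apply (lim_continuous Rinv); [|exact Hf].
now apply continuous_Rinv.
Qed.

Lemma lim_div (f g : X -> R) (l m : R) :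
  m <> 0 -> filterlim f F (locally l) -> filterlim g F (locally m) ->
  filterlim (fun x => f x / g x) F (locally (l / m)).
Proof. intros Hm Hf Hg. apply lim_mult; [exact Hf|now apply lim_inv]. Qed.

Lemma lim_const (c : R) : filterlim (fun _ : X => c) F (locally c).
Proof. apply filterlim_const. Qed.

Lemma lim_squeeze0 (f g : X -> R) :
  F (fun x => 0 <= f x <= g x) -> filterlim g F (locally 0) ->
  filterlim f F (locally 0).
Proof.
intros Hfg Hg.
apply filterlim_locally. intros eps.
generalize (filter_and _ _ Hfg (proj1 (filterlim_locally g 0) Hg eps)).
apply filter_imp. intros x [H Hx].
unfold ball in *; cbn in *; unfold AbsRing_ball, abs, minus, plus, opp in *;
  cbn in *.
rewrite Rabs_pos_eq by lra. rewrite Rabs_pos_eq in Hx by lra. lra.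
Qed.

Lemma lim_eventually_lt (f : X -> R) (l c : R) :
  l < c -> filterlim f F (locally l) -> F (fun x => f x < c).
Proof. intros Hl Hf. exact (Hf _ (open_lt c l Hl)). Qed.

End RealLimits.

(** The shape of the formula dictates the rule; leaves are known limits or
    constants. Division is tried only after a product
    whose second factor has a known limit, because a reciprocal may have a known limit
    when the divisor has none, as [/ T] does at infinity. Nonzero limits of
    divisors are left as goals. *)
Ltac lim_compute :=
  repeat first [ eassumption | typeclasses eauto | apply lim_const | apply lim_minus
               | apply lim_plus | apply lim_opp
               | (apply lim_mult; [.. | eassumption])
               | apply lim_div | apply lim_mult ].

(** * The Hugoniot equation in terms of the pressure ratio *)

(** The temperature factor of [p / p0] once the factor
    [(1 - alpha^2) / alpha^2] is split off; [kappa] cancels. *)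
Definition saha_factor (Ti alpha0 T0 T : R) : R :=
  alpha0 ^ 2 / (1 - alpha0 ^ 2) * Rpower (T / T0) (5 / 2)
  * exp (Ti / T0 - Ti / T).

(** Here [A] and [B] are meant to be [2 (1 + alpha0) T0 + Ti alpha0] and
    [(1 + alpha0) T0], and [g] the Saha factor at [T]. *)
Definition hugoniot_balance (Ti A B g a T : R) : Prop :=
  let r := (1 - a ^ 2) / a ^ 2 * g in
  B / 2 * r + A = 2 * (1 + a) * T + Ti * a + (1 + a) * T / (2 * r).

Lemma saha_factor_pos (Ti alpha0 T0 T : R) :
  0 < alpha0 < 1 -> 0 < saha_factor Ti alpha0 T0 T.
Proof.
intros H. unfold saha_factor.
assert (0 < 1 - alpha0 ^ 2) by nra.
apply Rmult_lt_0_compat; [apply Rmult_lt_0_compat|apply exp_pos].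
- apply Rdiv_lt_0_compat; nra.
- apply exp_pos.
Qed.

Lemma pressure_pos (Ti kappa a T : R) :
  0 < kappa -> 0 < a < 1 -> 0 < pressure Ti kappa a T.
Proof.
intros Hk Ha. unfold pressure.
assert (0 < 1 - a ^ 2) by nra.
assert (0 < a ^ 2) by nra.
repeat apply Rmult_lt_0_compat; try apply exp_pos.
- lra.
- now apply Rinv_0_lt_compat.
- assumption.
- now apply Rinv_0_lt_compat.
Qed.

Lemma pressure_ratio (Ti kappa alpha0 T0 a T : R) :
  0 < kappa -> 0 < alpha0 < 1 -> 0 < T0 -> 0 < a < 1 -> 0 < T ->
  pressure Ti kappa a T
  = (1 - a ^ 2) / a ^ 2 * saha_factor Ti alpha0 T0 T
    * pressure Ti kappa alpha0 T0.
Proof.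
intros Hk H0 HT0 Ha HT. unfold pressure, saha_factor.
assert (Hp : Rpower T (5 / 2) = Rpower (T / T0) (5 / 2) * Rpower T0 (5 / 2)).
{ rewrite Rpower_mult_distr; [|apply Rdiv_lt_0_compat; lra|lra].
  f_equal. field. lra. }
assert (He : exp (- (Ti / T)) = exp (Ti / T0 - Ti / T) * exp (- (Ti / T0))).
{ rewrite <- exp_plus. f_equal. ring. }
rewrite Hp, He. field. repeat split; nra.
Qed.

Lemma locus_balance (a2 Ti kappa alpha0 T0 a T : R) :
  0 < a2 -> 0 < kappa -> 0 < alpha0 < 1 -> 0 < T0 ->
  hugoniot_locus a2 Ti kappa alpha0 T0 a T ->
  hugoniot_balance Ti (2 * (1 + alpha0) * T0 + Ti * alpha0)
    ((1 + alpha0) * T0) (saha_factor Ti alpha0 T0 T) a T.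
Proof.
intros Ha2 Hk H0 HT0 (Ha & HT & He).
unfold hugoniot_balance, specific_volume, internal_energy in *.
rewrite (pressure_ratio Ti kappa alpha0 T0 a T) in He by assumption.
assert (Hr : 0 < (1 - a ^ 2) / a ^ 2 * saha_factor Ti alpha0 T0 T).
{ apply Rmult_lt_0_compat; [apply Rdiv_lt_0_compat; nra|].
  now apply saha_factor_pos. }
set (r := (1 - a ^ 2) / a ^ 2 * saha_factor Ti alpha0 T0 T) in *.
assert (Hp := pressure_pos Ti kappa alpha0 T0 Hk H0).
set (p0 := pressure Ti kappa alpha0 T0) in *.
apply Rminus_diag_uniq. apply (Rmult_eq_reg_l (- a2)); [|lra].
rewrite Rmult_0_r, <- He. field. lra.
Qed.

(** * The balance at low and at high temperature *)

Lemma balance_ratio_pos (g a : R) :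
  0 < a < 1 -> 0 < g -> 0 < (1 - a ^ 2) / a ^ 2 * g.
Proof.
intros Ha Hg. apply Rmult_lt_0_compat; [|exact Hg].
apply Rdiv_lt_0_compat; nra.
Qed.

(** Keep only the term [(1 + a) T / (2 r) <= A + B r / 2] of the balance and
    use [a^2 r <= g]. *)
Lemma balance_alpha4_bound (Ti A B g a T : R) :
  0 < Ti -> 0 < A -> 0 < B -> 0 < g -> 0 < a < 1 -> 0 < T ->
  hugoniot_balance Ti A B g a T ->
  (a ^ 2) ^ 2 <= 2 * (g / T) * (A + B / 2 * g).
Proof.
intros HTi HA HB Hg Ha HT H. unfold hugoniot_balance in H.
assert (Hr := balance_ratio_pos g a Ha Hg).
assert (Hrg : a ^ 2 * ((1 - a ^ 2) / a ^ 2 * g) = (1 - a ^ 2) * g)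
  by (field; lra).
cbv zeta in H.
set (r := (1 - a ^ 2) / a ^ 2 * g) in *.
assert (Hle : T / 2 <= r * (A + B / 2 * r)).
{ replace (A + B / 2 * r)
    with (2 * (1 + a) * T + Ti * a + (1 + a) * T / (2 * r)) by lra.
  replace (r * (2 * (1 + a) * T + Ti * a + (1 + a) * T / (2 * r)))
    with (r * (2 * (1 + a) * T + Ti * a) + (1 + a) * T / 2) by (field; lra).
  assert (0 < a * T) by nra. assert (0 < Ti * a) by nra.
  assert (0 < r * (2 * (1 + a) * T + Ti * a)) by (apply Rmult_lt_0_compat; lra).
  lra. }
assert (Hs : 0 < a ^ 2 < 1) by nra.
set (s := a ^ 2) in *.
assert (Hsr : 0 < s * r <= g) by (split; [apply Rmult_lt_0_compat; lra|nra]).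
apply (Rmult_le_reg_l (T / 2)); [lra|].
replace (T / 2 * (2 * (g / T) * (A + B / 2 * g))) with (g * (A + B / 2 * g))
  by (field; lra).
apply Rle_trans with ((s * r) * (A * s + B / 2 * (s * r))).
- replace ((s * r) * (A * s + B / 2 * (s * r)))
    with (r * (A + B / 2 * r) * s ^ 2) by ring.
  apply Rmult_le_compat_r; [nra|exact Hle].
- assert (0 < A * s <= A) by (split; nra).
  assert (0 < B / 2 * (s * r) <= B / 2 * g)
    by (split; [apply Rmult_lt_0_compat; lra|apply Rmult_le_compat_l; lra]).
  apply Rmult_le_compat; lra.
Qed.

(** The bound on [alpha^4] comes first: only once [alpha] is known to be small
    is the coefficient [A - Ti alpha - 2 (1 + alpha) T] of [r] in the balance
    multiplied by [r] bounded below by [A / 2], which forces [r] to vanish. *)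
Lemma cold_limit (F : (R -> Prop) -> Prop) {FF : Filter F} (Ti A B : R)
  (G alpha : R -> R) :
  0 < Ti -> 0 < A -> 0 < B ->
  (forall T, 0 < T -> 0 < G T) ->
  (forall T, 0 < T -> 0 < alpha T < 1) ->
  (forall T, 0 < T -> hugoniot_balance Ti A B (G T) (alpha T) T) ->
  F (fun T => 0 < T) ->
  filterlim (fun T => T) F (locally 0) ->
  filterlim (fun T => G T / T) F (locally 0) ->
  filterlim alpha F (locally 0) /\
  filterlim (fun T => alpha T ^ 2 / (G T / T)) F (locally (2 * A)).
Proof.
intros HTi HA HB HG Ha Hbal HF0 HT HGT.
assert (HG0 : filterlim G F (locally 0)).
{ apply (filterlim_ext_loc (fun T => T * (G T / T))).
  - revert HF0; apply filter_imp; intros T H. field. lra.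
  - eapply lim_eq; [|lim_compute]. ring. }
assert (Halpha : filterlim alpha F (locally 0)).
{ apply (filterlim_ext_loc (fun T => sqrt (sqrt ((alpha T ^ 2) ^ 2)))).
  - revert HF0; apply filter_imp; intros T H. specialize (Ha T H).
    rewrite !sqrt_pow2; nra.
  - rewrite <- sqrt_0. apply (lim_continuous F sqrt); [apply continuous_sqrt|].
    rewrite <- sqrt_0. apply (lim_continuous F sqrt); [apply continuous_sqrt|].
    apply (lim_squeeze0 F _ (fun T => 2 * (G T / T) * (A + B / 2 * G T))).
    + revert HF0; apply filter_imp; intros T H. split; [apply pow2_ge_0|].
      apply (balance_alpha4_bound Ti A B); auto.
    + eapply lim_eq; [|lim_compute]. ring. }
split; [exact Halpha|].
set (r := fun T => (1 - alpha T ^ 2) / alpha T ^ 2 * G T).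
assert (Hr : filterlim r F (locally 0)).
{ apply (lim_squeeze0 F _ (fun T => 2 / A * T)).
  - assert (Hsmall : F (fun T => Ti * alpha T + 4 * T < A / 2)).
    { apply (lim_eventually_lt F _ 0); [lra|].
      eapply lim_eq; [|lim_compute]. ring. }
    generalize (filter_and _ _ HF0 Hsmall).
    apply filter_imp. intros T [H Hs].
    specialize (Ha T H). specialize (Hbal T H). specialize (HG T H).
    assert (Hr := balance_ratio_pos (G T) (alpha T) Ha HG).
    unfold hugoniot_balance in Hbal. fold (r T) in Hbal, Hr.
    cbv zeta in Hbal.
    assert (Hq : r T * (B / 2 * r T + A - 2 * (1 + alpha T) * T - Ti * alpha T)
                 = (1 + alpha T) * T / 2).
    { rewrite Hbal. field. lra. }
    split; [lra|].
    apply (Rmult_le_reg_l (A / 2)); [lra|].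
    replace (A / 2 * (2 / A * T)) with T by (field; lra).
    assert (alpha T * T <= T) by nra.
    assert (0 < B / 2 * r T) by nra.
    assert (A / 2 * r T
      <= r T * (B / 2 * r T + A - 2 * (1 + alpha T) * T - Ti * alpha T)) by nra.
    lra.
  - eapply lim_eq; [|lim_compute]. ring. }
(* The balance solved for [T / r], with [alpha^2 = (1 - alpha^2) G / r]. *)
apply (filterlim_ext_loc (fun T =>
  (1 - alpha T * alpha T) * (2 / (1 + alpha T)
    * (B / 2 * r T + A - 2 * (1 + alpha T) * T - Ti * alpha T)))).
- revert HF0; apply filter_imp; intros T H.
  specialize (Ha T H). specialize (Hbal T H). specialize (HG T H).
  assert (Hrp := balance_ratio_pos (G T) (alpha T) Ha HG).
  unfold hugoniot_balance in Hbal. fold (r T) in Hbal, Hrp.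
  cbv zeta in Hbal. rewrite Hbal.
  replace (2 * (1 + alpha T) * T + Ti * alpha T + (1 + alpha T) * T / (2 * r T)
    - 2 * (1 + alpha T) * T - Ti * alpha T)
    with ((1 + alpha T) * T / (2 * r T)) by ring.
  unfold r. field. repeat split; try lra. nra.
- eapply lim_eq; [|lim_compute]; [field|lra].
Qed.

(** Saha's law reads [1 - alpha = (r / T) (T / G) alpha^2 / (1 + alpha)], where
    the balance controls [r / T]: bounded at first, and convergent to [8 / B]
    once [alpha] is known to tend to 1. *)
Lemma hot_limit (Ti A B : R) (G alpha : R -> R) :
  0 < Ti -> 0 < A -> 0 < B ->
  (forall T, 0 < T -> 0 < G T) ->
  (forall T, 0 < T -> 0 < alpha T < 1) ->
  (forall T, 0 < T -> hugoniot_balance Ti A B (G T) (alpha T) T) ->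
  filterlim (fun T => T / G T) (Rbar_locally p_infty) (locally 0) ->
  filterlim alpha (Rbar_locally p_infty) (locally 1) /\
  filterlim (fun T => (1 - alpha T) * (G T / T)) (Rbar_locally p_infty)
    (locally (4 / B)).
Proof.
intros HTi HA HB HG Ha Hbal HTG.
set (F := Rbar_locally p_infty) in *.
assert (FF : Filter F) by (unfold F; apply filter_filter).
assert (Hinv : filterlim Rinv F (locally 0)).
{ exact (filterlim_Rbar_inv p_infty ltac:(discriminate)). }
set (r := fun T => (1 - alpha T ^ 2) / alpha T ^ 2 * G T).
assert (Hpos : forall T, 0 < T -> 0 < r T)
  by (intros T H; apply balance_ratio_pos; auto).
assert (Hbalr : forall T, 0 < T -> B / 2 * r T + A
  = 2 * (1 + alpha T) * T + Ti * alpha T + (1 + alpha T) * T / (2 * r T))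
  by (intros T H; exact (Hbal T H)).
(* For [T > A], the term [2 T] alone outweighs [A], so [B / 2 * r >= T]. *)
assert (Hgrow : F (fun T => 0 < T /\ / r T <= B / 2 * / T)).
{ exists A. intros T HAT.
  assert (H : 0 < T) by lra. split; [exact H|].
  specialize (Ha T H). specialize (Hpos T H). specialize (Hbalr T H).
  assert (0 < (1 + alpha T) * T / (2 * r T)) by (apply Rdiv_lt_0_compat; nra).
  assert (HTr : T <= B / 2 * r T) by nra.
  apply (Rmult_le_reg_l (r T)); [lra|].
  rewrite Rinv_r by lra.
  apply (Rmult_le_reg_r T); [lra|].
  replace (r T * (B / 2 * / T) * T) with (B / 2 * r T) by (field; lra). lra. }
assert (Hrinv : filterlim (fun T => / r T) F (locally 0)).
{ apply (lim_squeeze0 F _ (fun T => B / 2 * / T)).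
  - revert Hgrow; apply filter_imp; intros T [H H'].
    split; [left; apply Rinv_0_lt_compat; auto|exact H'].
  - eapply lim_eq; [|lim_compute]. ring. }
assert (HF0 : F (fun T => 0 < T)) by (exists 0; auto).
(* The balance divided by [T]. *)
assert (HrT : forall T, 0 < T -> r T / T
  = 2 / B * (2 * (1 + alpha T) + (Ti * alpha T - A) * / T
             + (1 + alpha T) / 2 * / r T)).
{ intros T H. specialize (Hbalr T H). specialize (Hpos T H).
  apply (Rmult_eq_reg_l (B / 2 * T)); [|nra].
  transitivity (B / 2 * r T); [field; lra|].
  replace (B / 2 * r T) with (2 * (1 + alpha T) * T + Ti * alpha T
    + (1 + alpha T) * T / (2 * r T) - A) by lra.
  field. lra. }
assert (Hsaha : forall T, 0 < T ->
  1 - alpha T = r T / T * (T / G T) * (alpha T ^ 2 / (1 + alpha T))).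
{ intros T H. specialize (Ha T H). specialize (HG T H).
  unfold r. field. repeat split; lra. }
assert (Halpha1 : filterlim (fun T => 1 - alpha T) F (locally 0)).
{ apply (lim_squeeze0 F _
    (fun T => 2 / B * (4 + Ti * / T + / r T) * (T / G T))).
  - revert HF0; apply filter_imp; intros T H.
    split; [specialize (Ha T H); lra|].
    rewrite (Hsaha T H), (HrT T H).
    specialize (Ha T H). specialize (HG T H). specialize (Hpos T H).
    assert (HrT0 : 0 < r T / T) by (apply Rdiv_lt_0_compat; lra).
    rewrite HrT in HrT0 by exact H.
    assert (HT0 : 0 < / T) by (now apply Rinv_0_lt_compat).
    assert (Hr0 : 0 < / r T) by (now apply Rinv_0_lt_compat).
    assert (HTG0 : 0 < T / G T) by (apply Rdiv_lt_0_compat; lra).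
    assert (Hfrac : 0 <= alpha T ^ 2 / (1 + alpha T) <= 1).
    { split; [left; apply Rdiv_lt_0_compat; nra|].
      apply (Rmult_le_reg_r (1 + alpha T)); [lra|].
      replace (alpha T ^ 2 / (1 + alpha T) * (1 + alpha T)) with (alpha T ^ 2)
        by (field; lra). nra. }
    assert (HB0 : 0 < 2 / B) by (apply Rdiv_lt_0_compat; lra).
    rewrite <- (Rmult_1_r (2 / B * (4 + Ti * / T + / r T) * (T / G T))).
    assert (Hle : 2 * (1 + alpha T) + (Ti * alpha T - A) * / T
      + (1 + alpha T) / 2 * / r T <= 4 + Ti * / T + / r T).
    { assert ((Ti * alpha T - A) * / T <= Ti * / T)
        by (apply Rmult_le_compat_r; nra).
      assert ((1 + alpha T) / 2 * / r T <= / r T) by nra.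
      lra. }
    apply Rmult_le_compat; [|lra| |lra].
    + apply Rmult_le_pos; lra.
    + apply Rmult_le_compat_r; [lra|]. apply Rmult_le_compat_l; lra.
  - eapply lim_eq; [|lim_compute]. ring. }
assert (Halpha : filterlim alpha F (locally 1)).
{ apply (filterlim_ext (fun T => 1 - (1 - alpha T))); [intros T; ring|].
  eapply lim_eq; [|lim_compute]. ring. }
split; [exact Halpha|].
apply (filterlim_ext_loc (fun T =>
  2 / B * (2 * (1 + alpha T) + (Ti * alpha T - A) * / T
             + (1 + alpha T) / 2 * / r T)
  * (alpha T * alpha T / (1 + alpha T)))).
- revert HF0; apply filter_imp; intros T H.
  rewrite (Hsaha T H), <- (HrT T H).
  specialize (Ha T H). specialize (HG T H). field. lra.
- eapply lim_eq; [|lim_compute]; [field; lra|lra..].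
Qed.

(** * The Saha factor at extreme temperatures *)

Lemma saha_factor_over_T (Ti alpha0 T0 T : R) :
  0 < alpha0 < 1 -> 0 < T0 -> 0 < T ->
  saha_factor Ti alpha0 T0 T / T
  = alpha0 ^ 2 / ((1 - alpha0 ^ 2) * T0) * exp (Ti / T0)
    * Rpower (T / T0) (3 / 2) * exp (- (Ti / T)).
Proof.
intros H0 HT0 HT. unfold saha_factor, Rminus at 2.
assert (0 < T / T0) by (apply Rdiv_lt_0_compat; lra).
replace (5 / 2) with (3 / 2 + 1) by field.
rewrite Rpower_plus, Rpower_1, exp_plus by assumption.
field. repeat split; nra.
Qed.

(** The exponential already vanishes: [e^(- Ti / T) <= T / Ti]. *)
Lemma saha_factor_over_T_cold (Ti alpha0 T0 : R) :
  0 < Ti -> 0 < alpha0 < 1 -> 0 < T0 ->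
  filterlim (fun T => saha_factor Ti alpha0 T0 T / T) (at_right 0) (locally 0).
Proof.
intros HTi H0 HT0.
set (c := alpha0 ^ 2 / ((1 - alpha0 ^ 2) * T0) * exp (Ti / T0)).
assert (Hc : 0 < c).
{ apply Rmult_lt_0_compat; [|apply exp_pos].
  apply Rdiv_lt_0_compat; [nra|]. apply Rmult_lt_0_compat; nra. }
assert (Hid : filterlim (fun T : R => T) (at_right 0) (locally 0)).
{ intros P HP. unfold filtermap, at_right, within.
  revert HP; apply filter_imp; auto. }
apply (lim_squeeze0 _ _ (fun T => c * (T * / Ti))).
- assert (Hlt : at_right 0 (fun T => T < T0))
    by exact (lim_eventually_lt _ _ 0 T0 HT0 Hid).
  assert (Hpos : at_right 0 (fun T => 0 < T))
    by (unfold at_right, within; apply filter_forall; auto).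
  generalize (filter_and _ _ Hpos Hlt); apply filter_imp; intros T [HT HTT].
  split.
  { left; apply Rdiv_lt_0_compat; [now apply saha_factor_pos|exact HT]. }
  rewrite saha_factor_over_T by assumption. fold c. rewrite Rmult_assoc.
  apply Rmult_le_compat_l; [lra|].
  rewrite <- (Rmult_1_l (T * / Ti)).
  apply Rmult_le_compat; [left; apply exp_pos|left; apply exp_pos| |].
  + replace 1 with (Rpower 1 (3 / 2)).
    * apply Rle_Rpower_l; [lra|]. split; [apply Rdiv_lt_0_compat; lra|].
      apply Rmult_le_reg_r with T0; [lra|].
      replace (T / T0 * T0) with T by (field; lra). lra.
    * unfold Rpower. now rewrite ln_1, Rmult_0_r, exp_0.
  + rewrite exp_Ropp. replace (T * / Ti) with (/ (Ti / T)) by (field; lra).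
    assert (0 < Ti / T) by (apply Rdiv_lt_0_compat; lra).
    apply Rinv_le_contravar; [assumption|].
    left; apply Rlt_trans with (1 + Ti / T); [lra|].
    apply exp_ineq1; lra.
- eapply lim_eq; [|lim_compute]; [field|]; lra.
Qed.

Lemma exp_inv_T_hot (Ti : R) :
  filterlim (fun T => exp (Ti * / T)) (Rbar_locally p_infty) (locally 1).
Proof.
rewrite <- exp_0.
apply (lim_continuous _ exp); [apply continuous_exp|].
rewrite <- (Rmult_0_r Ti).
apply (lim_mult _ _ _ _ _ (lim_const _ _)).
exact (filterlim_Rbar_inv p_infty ltac:(discriminate)).
Qed.

(** For [T > T0], the power [3 / 2] of [T / T0] dominates [T / T0] itself, and
    the exponential tends to 1. *)
Lemma T_over_saha_factor_hot (Ti alpha0 T0 : R) :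
  0 < alpha0 < 1 -> 0 < T0 ->
  filterlim (fun T => T / saha_factor Ti alpha0 T0 T)
    (Rbar_locally p_infty) (locally 0).
Proof.
intros H0 HT0.
set (c := alpha0 ^ 2 / ((1 - alpha0 ^ 2) * T0) * exp (Ti / T0)).
assert (Hc : 0 < c).
{ apply Rmult_lt_0_compat; [|apply exp_pos].
  apply Rdiv_lt_0_compat; [nra|]. apply Rmult_lt_0_compat; nra. }
assert (Hinv : filterlim Rinv (Rbar_locally p_infty) (locally 0))
  by exact (filterlim_Rbar_inv p_infty ltac:(discriminate)).
assert (Hexp := exp_inv_T_hot Ti).
apply (lim_squeeze0 _ _ (fun T => / c * (T0 * / T) * exp (Ti * / T))).
- exists T0. intros T HTT. assert (HT : 0 < T) by lra.
  assert (Hg := saha_factor_pos Ti alpha0 T0 T H0).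
  split; [left; now apply Rdiv_lt_0_compat|].
  replace (T / saha_factor Ti alpha0 T0 T)
    with (/ (saha_factor Ti alpha0 T0 T / T)) by (field; lra).
  rewrite saha_factor_over_T by assumption. fold c.
  rewrite !Rinv_mult, exp_Ropp, Rinv_inv.
  apply Rmult_le_compat_r; [left; apply exp_pos|].
  apply Rmult_le_compat_l; [left; now apply Rinv_0_lt_compat|].
  replace (T0 * / T) with (/ (T / T0)) by (field; lra).
  assert (H1 : 1 < T / T0).
  { apply Rmult_lt_reg_r with T0; [lra|].
    replace (T / T0 * T0) with T by (field; lra). lra. }
  apply Rinv_le_contravar; [lra|].
  rewrite <- (Rpower_1 (T / T0)) at 1 by lra.
  apply Rle_Rpower; lra.
- eapply lim_eq; [|lim_compute]. ring.
Qed.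

(** * The two asymptotic equivalents *)

Lemma Rpow2_div (x y : R) : (x / y) ^ 2 = x ^ 2 / y ^ 2.
Proof. unfold Rdiv. now rewrite Rpow_mult_distr, pow_inv. Qed.

(** Squaring clears the half-integer powers and brings the announced
    equivalent to the form [2 A G(T) / T] in which [cold_limit] gives
    [alpha^2]. *)
Lemma cold_equivalent_square (Ti alpha0 T0 T : R) :
  0 < Ti -> 0 < alpha0 < 1 -> 0 < T0 -> 0 < T ->
  (2 * alpha0 / sqrt (1 - alpha0)
   * Rpower (1 + Ti * alpha0 / (2 * T0 * (1 + alpha0))) (1 / 2)
   * Rpower (T / T0) (3 / 4)
   * exp (- (Ti / (2 * T)) + Ti / (2 * T0))) ^ 2
  = 2 * (2 * (1 + alpha0) * T0 + Ti * alpha0)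
    * (saha_factor Ti alpha0 T0 T / T).
Proof.
intros HTi H0 HT0 HT.
assert (HX : 0 < 1 + Ti * alpha0 / (2 * T0 * (1 + alpha0))).
{ assert (0 < Ti * alpha0 / (2 * T0 * (1 + alpha0)))
    by (apply Rdiv_lt_0_compat; repeat apply Rmult_lt_0_compat; lra). lra. }
rewrite saha_factor_over_T by assumption.
rewrite !Rpow_mult_distr, Rpow2_div, Rpow_mult_distr.
assert (Hsq : forall x y, Rpower x y ^ 2 = Rpower x (y + y))
  by (intros; rewrite Rpower_plus; ring).
rewrite !Hsq, pow2_sqrt by lra.
replace (1 / 2 + 1 / 2) with 1 by field. rewrite Rpower_1 by exact HX.
replace (3 / 4 + 3 / 4) with (3 / 2) by field.
replace (exp (- (Ti / (2 * T)) + Ti / (2 * T0)) ^ 2)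
  with (exp (Ti / T0) * exp (- (Ti / T))).
- field. repeat split; nra.
- rewrite <- exp_plus. simpl. rewrite Rmult_1_r, <- exp_plus.
  f_equal. field. lra.
Qed.

(** The right-hand side is the equivalent [4 T / (B G(T))] given by
    [hot_limit], up to the factor [e^(- Ti / T)], which tends to 1. *)
Lemma hot_equivalent_saha (Ti alpha0 T0 T : R) :
  0 < alpha0 < 1 -> 0 < T0 -> 0 < T ->
  4 * ((1 - alpha0) / alpha0 ^ 2) * Rpower (T / T0) (- (3 / 2))
    * exp (- (Ti / T0))
  = 4 / ((1 + alpha0) * T0)
    * / (saha_factor Ti alpha0 T0 T / T * exp (Ti * / T)).
Proof.
intros H0 HT0 HT. change (Ti * / T) with (Ti / T).
rewrite saha_factor_over_T, Rpower_Ropp, !exp_Ropp by assumption.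
assert (Hp : 0 < Rpower (T / T0) (3 / 2)) by apply exp_pos.
assert (He := exp_pos (Ti / T0)). assert (He' := exp_pos (Ti / T)).
field. repeat split; nra.
Qed.

Theorem proposition5p3 (a2 Ti kappa : R) (ha2 : 0 < a2) (hTi : 0 < Ti)
  (hkappa : 0 < kappa) (alpha0 T0 : R) (halpha0 : 0 < alpha0 < 1) (hT0 : 0 < T0)
  (alpha : R -> R) (halpha : is_locus_function a2 Ti kappa alpha0 T0 alpha) :
  (filterlim alpha (at_right 0) (locally 0) /\
   asymp_equiv (at_right 0) alpha
     (fun T => 2 * alpha0 / sqrt (1 - alpha0)
        * Rpower (1 + Ti * alpha0 / (2 * T0 * (1 + alpha0))) (1 / 2)
        * Rpower (T / T0) (3 / 4)
        * exp (- (Ti / (2 * T)) + Ti / (2 * T0)))) /\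
  (filterlim alpha (Rbar_locally p_infty) (locally 1) /\
   asymp_equiv (Rbar_locally p_infty) (fun T => 1 - alpha T)
     (fun T => 4 * ((1 - alpha0) / alpha0 ^ 2)
        * Rpower (T / T0) (- (3 / 2))
        * exp (- (Ti / T0)))).
Proof.
assert (Hlocus : forall T, 0 < T ->
  hugoniot_locus a2 Ti kappa alpha0 T0 (alpha T) T)
  by (intros T HT; apply halpha; auto).
assert (Ha : forall T, 0 < T -> 0 < alpha T < 1)
  by (intros T HT; apply (Hlocus T HT)).
assert (Hbal := fun T HT => locus_balance a2 Ti kappa alpha0 T0 (alpha T) T
  ha2 hkappa halpha0 hT0 (Hlocus T HT)).
set (A := 2 * (1 + alpha0) * T0 + Ti * alpha0) in *.
set (B := (1 + alpha0) * T0) in *.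
assert (HB : 0 < B) by (apply Rmult_lt_0_compat; lra).
assert (HA : 0 < A).
{ assert (0 < Ti * alpha0) by (apply Rmult_lt_0_compat; lra).
  unfold A; fold B; unfold B in HB; lra. }
assert (HG : forall T, 0 < T -> 0 < saha_factor Ti alpha0 T0 T)
  by (intros; now apply saha_factor_pos).
split.
- assert (HF0 : at_right 0 (fun T => 0 < T))
    by (unfold at_right, within; apply filter_forall; auto).
  assert (Hid : filterlim (fun T : R => T) (at_right 0) (locally 0)).
  { intros P HP. unfold filtermap, at_right, within.
    revert HP; apply filter_imp; auto. }
  destruct (cold_limit (at_right 0) Ti A B (saha_factor Ti alpha0 T0) alpha)
    as [Hlim Hsq]; auto using saha_factor_over_T_cold.
  split; [exact Hlim|]. unfold asymp_equiv.
  apply (filterlim_ext_loc (fun T => sqrt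
    (alpha T ^ 2 / (saha_factor Ti alpha0 T0 T / T) / (2 * A)))).
  + revert HF0; apply filter_imp; intros T HT.
    assert (Hequiv := cold_equivalent_square Ti alpha0 T0 T hTi halpha0 hT0 HT).
    fold A in Hequiv. revert Hequiv.
    set (g := _ * exp _). intros Hequiv.
    assert (Hg : 0 < g).
    { unfold g. repeat apply Rmult_lt_0_compat; try apply exp_pos; try lra.
      apply Rinv_0_lt_compat, sqrt_lt_R0; lra. }
    specialize (HG T HT). specialize (Ha T HT).
    rewrite <- (sqrt_pow2 (alpha T / g)).
    * f_equal. rewrite Rpow2_div, Hequiv. field. lra.
    * left; apply Rdiv_lt_0_compat; lra.
  + rewrite <- sqrt_1. apply (lim_continuous _ sqrt); [apply continuous_sqrt|].
    eapply lim_eq; [|lim_compute]; [field; lra|lra].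
- destruct (hot_limit Ti A B (saha_factor Ti alpha0 T0) alpha)
    as [Hlim Hprod]; auto using T_over_saha_factor_hot.
  split; [exact Hlim|]. unfold asymp_equiv.
  assert (Hexp := exp_inv_T_hot Ti).
  apply (filterlim_ext_loc (fun T => B / 4
    * ((1 - alpha T) * (saha_factor Ti alpha0 T0 T / T)) * exp (Ti * / T))).
  + exists 0. intros T HT. rewrite hot_equivalent_saha by assumption.
    fold B. specialize (HG T HT). assert (He := exp_pos (Ti * / T)).
    set (E := exp (Ti * / T)) in *. field. repeat split; lra.
  + eapply lim_eq; [|lim_compute]. field. lra.
Qed.
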